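(* For a metacompact space $X$ the games $G_{ufin}(\mathcal{O},\Omega)$ and $SG^{*}_{fin}(\mathcal{O},\Omega)$ on $X$ are equivalent.
   Context: A space is metacompact if every open cover has a point-finite open refinement. For $A\subseteq X$ and a family $\mathcal{P}$ of subsets of $X$, $St(A,\mathcal{P})=\bigcup\{B\in\mathcal{P} : A\cap B\neq\emptyset\}$. An $\omega$-cover of $X$ is an open cover $\mathcal{U}$ such that every finite $F\subseteq X$ is contained in some member of $\mathcal{U}$. In both games players ONE and TWO play an inning for each positive integer $n$, and in the $n$th inning ONE chooses an open cover $\mathcal{U}_n$ of $X$. In $G_{ufin}(\mathcal{O},\Omega)$ TWO responds with a finite subset $\mathcal{V}_n\subseteq\mathcal{U}_n$, and TWO wins the play if $\{\bigcup\mathcal{V}_n : n\in\mathbb{N}\}$ is an $\omega$-cover of $X$; otherwise ONE wins. In $SG^{*}_{fin}(\mathcal{O},\Omega)$ TWO responds with a finite set $F_n\subseteq X$, and TWO wins the play if $\{St(F_n,\mathcal{U}_n) : n\in\mathbb{N}\}$ is an $\omega$-cover of $X$; otherwise ONE wins. Two games are equivalent if whenever one of the players has a winning strategy in one of the games, that same player has a winning strategy in the other game. *)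

(* Defs.v *)
From mathcomp Require Import all_boot.
From mathcomp Require Import boolp classical_sets functions cardinality.
From mathcomp Require Import topology.

Set Implicit Arguments.
Unset Strict Implicit.
Unset Printing Implicit Defensive.

Local Open Scope classical_set_scope.

Section Covers.
Variable X : topologicalType.
Implicit Types (A : set X) (U V P : set (set X)).

Definition open_cover U := (forall B, U B -> open B) /\ cover U id = [set: X].

Definition refines V U := forall B, V B -> exists2 A, U A & B `<=` A.

Definition point_finite V := forall x, finite_set [set B | V B /\ B x].

Definition star A P := \bigcup_(B in [set B | P B /\ A `&` B !=set0]) B.

(* [set: X] is allowed as a member of an omega-cover. *)
Definition omega_cover U :=
  open_cover U /\ forall F, finite_set F -> exists2 A, U A & F `<=` A.

End Covers.

Definition metacompact (X : topologicalType) :=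
  forall U : set (set X), open_cover U ->
    exists V : set (set X), [/\ open_cover V, refines V U & point_finite V].

(* Games with one inning for each natural number (innings are numbered from 0),
   in which ONE moves first in each inning; [legal2 u t] says that TWO may
   answer ONE's move [u] with [t] in the same inning, and [two_wins_play u t]
   that TWO wins the play u_0, t_0, u_1, t_1, etc. *)
Record game := Game {
  move1 : Type;
  move2 : Type;
  legal1 : move1 -> Prop;
  legal2 : move1 -> move2 -> Prop;
  two_wins_play : (nat -> move1) -> (nat -> move2) -> Prop }.

Section Strategies.
Variable G : game.

(* A strategy for ONE maps the sequence of TWO's previous moves to ONE's next
   move; a strategy for TWO maps the sequence of ONE's moves, including the
   one of the current inning, to TWO's answer. *)
Definition play1 (sigma : seq (move2 G) -> move1 G) (t : nat -> move2 G) :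
  nat -> move1 G := fun n => sigma (mkseq t n).

Definition play2 (tau : seq (move1 G) -> move2 G) (u : nat -> move1 G) :
  nat -> move2 G := fun n => tau (mkseq u n.+1).

(* The first conjunct in the next two definitions says that the strategy makes
   a legal move at every position reached by legal moves of the opponent. *)
Definition winning1 (sigma : seq (move2 G) -> move1 G) :=
  forall t : nat -> move2 G,
    (forall n, (forall k, (k < n)%N -> legal2 (play1 sigma t k) (t k)) ->
       legal1 (play1 sigma t n)) /\
    ((forall n, legal2 (play1 sigma t n) (t n)) ->
       ~ two_wins_play (play1 sigma t) t).

Definition winning2 (tau : seq (move1 G) -> move2 G) :=
  forall u : nat -> move1 G,
    (forall n, (forall k, (k <= n)%N -> legal1 (u k)) ->
       legal2 (u n) (play2 tau u n)) /\
    ((forall n, legal1 (u n)) -> two_wins_play u (play2 tau u)).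

Definition one_has_winning_strategy := exists sigma, winning1 sigma.

Definition two_has_winning_strategy := exists tau, winning2 tau.

End Strategies.

Definition equivalent_games (G H : game) :=
  (one_has_winning_strategy G <-> one_has_winning_strategy H) /\
  (two_has_winning_strategy G <-> two_has_winning_strategy H).

Definition Gufin_O_Omega (X : topologicalType) : game :=
  @Game (set (set X)) (set (set X))
    (@open_cover X)
    (fun U V => finite_set V /\ V `<=` U)
    (fun _ V => omega_cover (range (fun n => \bigcup_(B in V n) B))).

Definition SGstarfin_O_Omega (X : topologicalType) : game :=
  @Game (set (set X)) (set X)
    (@open_cover X)
    (fun _ F => finite_set F)
    (fun U F => omega_cover (range (fun n => star (F n) (U n)))).

(* Main.v *)
Require Import Defs.
From mathcomp Require Import all_boot.
From mathcomp Require Import boolp classical_sets functions cardinality.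
From mathcomp Require Import topology.

(** A strategy for one game is turned into a strategy for the other by
    translating moves inning by inning. From [SG*_fin] to [G_ufin], a finite
    family [V] included in [U] is replaced by a finite set [F] meeting each
    nonempty member of [V], so that [St(F, U)] contains the union of [V].
    From [G_ufin] to [SG*_fin], a cover [U] is replaced by a point-finite open
    refinement [P]: a finite set [F] meets only finitely many members of [P],
    so [St(F, P)] is covered by finitely many members of [U]. *)

Set Implicit Arguments.
Unset Strict Implicit.
Unset Printing Implicit Defensive.

Local Open Scope classical_set_scope.

(* ONE's moves are translated from [G] to [H] by [f], and TWO's answers back
   from [H] to [G] by [g]. *)
Record game_translation (G H : game) (f : move1 G -> move1 H)
    (g : move1 G -> move2 H -> move2 G) : Prop := GameTranslation {
  translation_legal1 : forall u, legal1 u -> legal1 (f u);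
  translation_legal2 : forall u t,
    legal1 u -> legal2 (f u) t -> legal2 u (g u t);
  translation_wins : forall u t,
    (forall n, legal1 (u n)) -> (forall n, legal2 (f (u n)) (t n)) ->
    two_wins_play (f \o u) t -> two_wins_play u (fun n => g (u n) (t n)) }.

Section Translation.
Variables (G H : game) (f : move1 G -> move1 H).
Variable g : move1 G -> move2 H -> move2 G.
Hypothesis fgT : game_translation f g.

Lemma translation_two (u0 : move1 G) :
  two_has_winning_strategy H -> two_has_winning_strategy G.
Proof.
move=> [tau tauW].
(* [last u0 s] is ONE's current move; the default [u0] is never reached in a play, since TWO always
   answers a nonempty history. *)
exists (fun s => g (last u0 s) (tau (map f s))) => u.
have playE : play2 (fun s => g (last u0 s) (tau (map f s))) u =
    fun n => g (u n) (play2 tau (f \o u) n).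
  by apply: funext => n; rewrite /play2 -map_comp mkseqS last_rcons.
have [tau_legal tau_wins] := tauW (f \o u).
rewrite playE; split=> [n uL|uL].
  apply: (translation_legal2 fgT); first exact: uL.
  by apply: tau_legal => k kn; apply: (translation_legal1 fgT); exact: uL.
have fuL n : legal1 (f (u n)) by exact: (translation_legal1 fgT).
apply: (translation_wins fgT) => // [n|]; last exact: tau_wins.
by apply: tau_legal => k _; exact: fuL.
Qed.

(** Translating an answer back needs ONE's move in [G], which a strategy for [H] does not see; it is
    recovered by replaying [sigma] on the simulated history. *)
Lemma translation_one :
  one_has_winning_strategy G -> one_has_winning_strategy H.
Proof.
move=> [sigma sigmaW].
(* TWO's answers in [G] simulated from those in [H]. *)
pose hist := foldl (fun w t => rcons w (g (sigma w) t)) [::].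
exists (fun s => f (sigma (hist s))) => t.
pose w n := g (sigma (hist (mkseq t n))) (t n).
have histE n : hist (mkseq t n) = mkseq w n.
  elim: n => // n IHn.
  by rewrite !mkseqS /hist foldl_rcons -/hist /w IHn.
have playE : play1 (fun s => f (sigma (hist s))) t = f \o play1 sigma w.
  by apply: funext => n; rewrite /play1 histE.
have wE : w = fun n => g (play1 sigma w n) (t n).
  by apply: funext => n; rewrite /play1 -histE.
have [sigma_legal sigma_wins] := sigmaW w.
(* Strong induction: [sigma] moves legally only after legal simulated answers, and these are legal
   only against earlier legal moves of [sigma]. *)
have uL n : (forall k, (k < n)%N -> legal2 (f (play1 sigma w k)) (t k)) ->
    legal1 (play1 sigma w n).
  elim/ltn_ind: n => n IHn tL; apply: sigma_legal => k kn.
  have -> : w k = g (play1 sigma w k) (t k) by rewrite {1}wE.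
  apply: (translation_legal2 fgT); last exact: tL.
  by apply: IHn => // j jk; apply: tL; exact: ltn_trans jk kn.
rewrite playE; split=> [n tL|tL tW].
  by apply: (translation_legal1 fgT); exact: uL.
have {}uL n : legal1 (play1 sigma w n) by apply: uL => k _; exact: tL.
apply: sigma_wins => [n|].
  have -> : w n = g (play1 sigma w n) (t n) by rewrite {1}wE.
  by apply: (translation_legal2 fgT); [exact: uL|exact: tL].
by rewrite [X in two_wins_play _ X]wE; exact: (translation_wins fgT).
Qed.

End Translation.

Section StarCovers.
Variable X : topologicalType.
Implicit Types U V P : set (set X).

(** Enlarging each inning's set keeps finite sets captured; singletons then give the covering
    property. *)
Lemma omega_cover_range_le (A B : nat -> set X) : (forall n, open (B n)) ->
  (forall n, A n `<=` B n) -> omega_cover (range A) -> omega_cover (range B).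
Proof.
move=> Bo AB [_ Aomega].
have Bomega F : finite_set F -> exists2 C, range B C & F `<=` C.
  move=> /Aomega[_ [n _ <-] FA]; exists (B n); first by exists n.
  exact: subset_trans FA (AB n).
split=> //; split=> [_ [n _ <-] //|].
rewrite -subTset => x _.
have [C BC xC] := Bomega _ (finite_set1 x).
by exists C => //; exact: xC.
Qed.

Lemma open_star F U : open_cover U -> open (star F U).
Proof. by move=> [Uo _]; apply: bigcup_open => B [/Uo]. Qed.

Lemma finite_meeting_set V : finite_set V ->
  exists2 F : set X, finite_set F &
    forall B, V B -> B !=set0 -> F `&` B !=set0.
Proof.
move=> Vfin.
(* Sets of at most one point are chosen instead of points, since [B], or [X] itself, may be
   empty. *)
have /choice[p pP] (B : set X) : exists F : set X,
    finite_set F /\ (B !=set0 -> F `&` B !=set0).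
  have [[x Bx]|B0] := pselect (B !=set0).
    by exists [set x]; split=> [|_]; [exact: finite_set1|exists x].
  by exists set0; split=> // /B0.
exists (\bigcup_(B in V) p B).
  by apply: bigcup_finite => // B _; case: (pP B).
move=> B VB B0; have [x [pBx Bx]] := (pP B).2 B0.
by exists x; split=> //; exists B.
Qed.

Lemma finite_star_cover U P F : refines P U -> point_finite P ->
  finite_set F -> exists V, [/\ finite_set V, V `<=` U &
    star F P `<=` \bigcup_(B in V) B].
Proof.
move=> PU Pfin Ffin.
have /choice[r rP] (B : set X) : exists A, P B -> U A /\ B `<=` A.
  have [PB|nPB] := pselect (P B); last by exists set0 => /nPB.
  by have [A UA BA] := PU B PB; exists A.
pose Q := [set B | P B /\ F `&` B !=set0].
have Qfin : finite_set Q.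
  (* A member of [P] meeting [F] contains some point of [F], and each point lies in finitely many
     members. *)
  apply: (@sub_finite_set _ _ (\bigcup_(x in F) [set B | P B /\ B x])).
    by move=> B [PB [x [Fx Bx]]]; exists x.
  by apply: bigcup_finite => // x _; exact: Pfin.
exists (r @` Q); split; first exact: finite_image.
  by move=> _ [B [PB _] <-]; case: (rP B PB).
move=> x [B QB Bx]; exists (r B); first by exists B.
by have [_] := rP B QB.1; exact.
Qed.

Lemma SGstarfin_to_Gufin : exists g,
  @game_translation (SGstarfin_O_Omega X) (Gufin_O_Omega X) id g.
Proof.
have /choice[p pP] V : exists F : set X, finite_set V ->
    finite_set F /\ forall B, V B -> B !=set0 -> F `&` B !=set0.
  have [Vfin|nVfin] := pselect (finite_set V); last by exists set0.
  by have [F] := finite_meeting_set Vfin; exists F.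
exists (fun _ => p); split=> //= [U V _ [/pP[]]//|U V Uc VU].
apply: omega_cover_range_le => [n|n x [B VB Bx]]; first exact: open_star.
have [Vfin VUn] := VU n.
(* The point [x] shows that [B] is nonempty, so the chosen finite set meets it. *)
exists B => //; split; first exact: VUn.
by apply: (pP _ Vfin).2 => //; exists x.
Qed.

Lemma Gufin_to_SGstarfin : metacompact X -> exists f g,
  @game_translation (Gufin_O_Omega X) (SGstarfin_O_Omega X) f g.
Proof.
move=> mcX.
have /choice[f fP] U : exists P, open_cover U ->
    [/\ open_cover P, refines P U & point_finite P].
  have [/mcX[P]|nUc] := pselect (open_cover U); first by exists P.
  by exists set0.
have /choice[g gP] (UF : set (set X) * set X) : exists V,
    open_cover UF.1 -> finite_set UF.2 -> [/\ finite_set V, V `<=` UF.1 &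
      star UF.2 (f UF.1) `<=` \bigcup_(B in V) B].
  have [[Uc Ffin]|nUF] := pselect (open_cover UF.1 /\ finite_set UF.2).
    have [_ PU Pfin] := fP _ Uc.
    by have [V] := finite_star_cover PU Pfin Ffin; exists V.
  by exists set0 => Uc Ffin; case: nUF.
exists f, (fun U F => g (U, F)); split=> /= [U /fP[]//|U F Uc Ffin|U F Uc Ffin].
  by have [] := gP (U, F) Uc Ffin.
apply: omega_cover_range_le => n; have [_ VU starV] := gP (_, _) (Uc n) (Ffin n).
  by apply: bigcup_open => B /VU; exact: (Uc n).1.
exact: starV.
Qed.

End StarCovers.

Theorem theorem5p2 (X : topologicalType) (HX : metacompact X) :
  equivalent_games (Gufin_O_Omega X) (SGstarfin_O_Omega X).
Proof.
have [p SG_to_G] := SGstarfin_to_Gufin X.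
have [f [g G_to_SG]] := Gufin_to_SGstarfin HX.
split; split.
(* ONE's winning strategies pass along a translation, TWO's against it, so each translation serves
   both players, in opposite directions. *)
- exact: translation_one G_to_SG.
- exact: translation_one SG_to_G.
- exact: (translation_two SG_to_G set0).
- exact: (translation_two G_to_SG set0).
Qed.
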